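(* Let $N_1, N_2, N^l_1, N^l_2, N^r_1, N^r_2$ be nets, let $a$ be an action and let $R \subseteq Act \times Act$. If $N_1 \mathrel{\leftrightarrow_{sp}} N_2$, then $a_{\mathcal N} N_1 \mathrel{\leftrightarrow_{sp}} a_{\mathcal N} N_2$ and $R_{\mathcal N}(N_1) \mathrel{\leftrightarrow_{sp}} R_{\mathcal N}(N_2)$. If $N^l_1 \mathrel{\leftrightarrow_{sp}} N^l_2$ and $N^r_1 \mathrel{\leftrightarrow_{sp}} N^r_2$, then $N^l_1 \parallel_{\mathcal N} N^r_1 \mathrel{\leftrightarrow_{sp}} N^l_2 \parallel_{\mathcal N} N^r_2$, and, if moreover the initial markings of $N^l_i$ and $N^r_i$ ($i=1,2$) are nonempty plain sets, $N^l_1 +_{\mathcal N} N^r_1 \mathrel{\leftrightarrow_{sp}} N^l_2 +_{\mathcal N} N^r_2$.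
   Context: $Act$ is a fixed infinite set of actions. A multiset over a set $X$ is a function $X\to\mathbb N$; $\le$, $+$, $-$ (when defined) and $\cap$ (pointwise minimum) are taken pointwise, and a multiset with all values $\le 1$ is identified with a plain set. A (typed) Petri net is a tuple $N=(S,T,F,M_0,A,\ell)$ with $S,T$ disjoint sets of places and transitions, $F:(S\times T)\cup(T\times S)\to\mathbb N$, initial marking $M_0\in\mathbb N^S$, a set $A\subseteq Act$ (the type) and a labelling $\ell:T\to A$. For $x\in S\cup T$, ${}^\bullet x(y)=F(y,x)$ and $x^\bullet(y)=F(x,y)$. A transition $t$ is enabled at a marking $M\in\mathbb N^S$ if ${}^\bullet t\le M$, and firing it yields $M-{}^\bullet t+t^\bullet$. A marking is reachable if it is obtained from $M_0$ by a finite sequence of firings. A Petri net has bounded parallelism if there is no reachable marking $M$ and multiset $U$ of transitions with infinitely many elements (counted with multiplicity) such that $\sum_{t\in U}{}^\bullet t\le M$. A ''net'' is a Petri net with bounded parallelism. Structure preserving bisimilarity: for nets $N_i=(S_i,T_i,F_i,M_i,A_i,\ell_i)$, $i=1,2$, a linking is a multiset $l\in\mathbb N^{S_1\times S_2}$; its projections are $\pi_1(l)(s_1)=\sum_{s_2\in S_2}l(s_1,s_2)$ and $\pi_2(l)(s_2)=\sum_{s_1\in S_1}l(s_1,s_2)$. An sp-bisimulation is a set $\mathcal B$ of linkings such that (i) whenever $c\le l\in\mathcal B$ and $\pi_1(c)={}^\bullet t_1$ for some $t_1\in T_1$, there are $t_2\in T_2$ with $\ell_2(t_2)=\ell_1(t_1)$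 and $\pi_2(c)={}^\bullet t_2$, and a linking $\bar c$ with $\pi_1(\bar c)=t_1^\bullet$, $\pi_2(\bar c)=t_2^\bullet$ and $l-c+\bar c\in\mathcal B$; (ii) symmetrically, whenever $c\le l\in\mathcal B$ and $\pi_2(c)={}^\bullet t_2$ for some $t_2\in T_2$, there are $t_1\in T_1$ and $\bar c$ with the same properties. $N_1\mathrel{\leftrightarrow_{sp}}N_2$ iff $A_1=A_2$ and some sp-bisimulation contains a linking $l$ with $\pi_1(l)=M_1$ and $\pi_2(l)=M_2$. Net operators (defined up to isomorphism): For $N=(S,T,F,M,A,\ell)$ and $a\in Act$, $a_{\mathcal N}N$ is obtained from $N$ by adding a fresh place $s_0$ and a fresh transition $t_a$ labelled $a$ with ${}^\bullet t_a=\{s_0\}$ and $t_a^\bullet=M$; its type is $A\cup\{a\}$ and its initial marking $\{s_0\}$. For $R\subseteq Act\times Act$, $R_{\mathcal N}(N)$ has type $\{b\mid \exists a\in A,(a,b)\in R\}$, the same places and initial marking as $N$, and a transition $t_b$ for each $t\in T$ and $b$ with $(\ell(t),b)\in R$, with ${}^\bullet t_b={}^\bullet t$, $t_b^\bullet=t^\bullet$ and label $b$. For $N_i=(S_i,T_i,F_i,M_i,A_i,\ell_i)$ ($i=1,2$), $N_1\parallel_{\mathcal N}N_2$ has type $A_1\cup A_2$ and is obtained from the disjoint union of $N_1$ and $N_2$ (initial marking $M_1+M_2$) by omitting all transitions whose label lies in $A_1\cap A_2$ and adding fresh transitions $(t_1,t_2)$ for all $t_i\in T_i$ with $\ell_1(t_1)=\ell_2(t_2)\in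 A_1\cap A_2$, with ${}^\bullet(t_1,t_2)={}^\bullet t_1+{}^\bullet t_2$, $(t_1,t_2)^\bullet=t_1^\bullet+t_2^\bullet$, label $\ell_1(t_1)$. If $M_1,M_2$ are nonempty plain sets, $N_1+_{\mathcal N}N_2$ has type $A_1\cup A_2$ and is obtained from the disjoint union of $N_1$ and $N_2$ by adding the set of fresh places $M_1\times M_2$, which is the initial marking of $N_1+_{\mathcal N}N_2$, and fresh transitions $t_i^K$ for every $t_i\in T_i$ and $\emptyset\ne K\le {}^\bullet t_i\cap M_i$, with label $\ell_i(t_i)$, ${}^\bullet t_1^K={}^\bullet t_1-K+(K\times M_2)$, ${}^\bullet t_2^K={}^\bullet t_2-K+(M_1\times K)$, and $(t_i^K)^\bullet=t_i^\bullet$. *)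

(* Defs.v *)
From Stdlib Require Import Arith List FinFun.

Set Implicit Arguments.
Unset Strict Implicit.
Unset Printing Implicit Defensive.

Definition mset (X : Type) : Type := X -> nat.

Definition mle {X} (m n : mset X) : Prop := forall x, m x <= n x.
Definition madd {X} (m n : mset X) : mset X := fun x => m x + n x.
(* Truncated; it is only meant to be used when [mle n m]. *)
Definition msub {X} (m n : mset X) : mset X := fun x => m x - n x.
Definition mcap {X} (m n : mset X) : mset X := fun x => Nat.min (m x) (n x).
Definition mempty {X} : mset X := fun _ => 0.
Definition mprod {X Y} (m : mset X) (n : mset Y) : mset (X * Y) :=
  fun p => m (fst p) * n (snd p).
Definition mdisj {X Y} (m : mset X) (n : mset Y) : mset (X + Y) :=
  fun z => match z with inl x => m x | inr y => n y end.

Definition nonempty {X} (m : mset X) : Prop := exists x, 0 < m x.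
Definition plain {X} (m : mset X) : Prop := forall x, m x <= 1.
Definition elem {X} (m : mset X) : Type := {x : X | 0 < m x}.

(* [sums_to f n]: the sum of the possibly infinite family [f], taken in
   N + {infinity}, is the natural number [n].  This forces finite support. *)
Definition sums_to {X} (f : X -> nat) (n : nat) : Prop :=
  exists s : list X,
    NoDup s /\ (forall x, f x <> 0 -> In x s) /\ list_sum (map f s) = n.

(* The number of elements, counted with multiplicity, is infinite. *)
Definition infinite_mset {X} (m : mset X) : Prop := ~ exists n, sums_to m n.

(* [pre t s] is F(s,t) and [post t s] is F(t,s). *)
Record PetriNet (Act : Type) : Type := {
  place : Type;
  trans : Type;
  pre : trans -> mset place;
  post : trans -> mset place;
  init : mset place;
  type : Act -> Prop;
  label : trans -> Act;
  label_type : forall t, type (label t)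
}.

Arguments place {Act} _.
Arguments trans {Act} _.
Arguments pre {Act} [_] _ _.
Arguments post {Act} [_] _ _.
Arguments init {Act} _ _.
Arguments type {Act} _ _.
Arguments label {Act} [_] _.
Arguments label_type {Act} [_] _.

Inductive reachable {Act} (N : PetriNet Act) : mset (place N) -> Prop :=
| reachable_init : reachable (init N)
| reachable_fire (M : mset (place N)) (t : trans N) :
    reachable M -> mle (pre t) M -> reachable (madd (msub M (pre t)) (post t)).

Definition bounded_parallelism {Act} (N : PetriNet Act) : Prop :=
  ~ exists (M : mset (place N)) (U : mset (trans N)),
      reachable M /\ infinite_mset U /\
      forall s, exists n, sums_to (fun t => U t * pre t s) n /\ n <= M s.

Record Net (Act : Type) : Type := {
  net_petri :> PetriNet Act;
  net_bounded : bounded_parallelism net_petri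
}.

Definition linking {Act} (N1 N2 : PetriNet Act) : Type :=
  mset (place N1 * place N2).

(* A projection of a linking may take infinite values, so "the projection of
   [l] equals the multiset [m]" is rendered as a relation. *)
Definition proj1_is {X Y} (l : mset (X * Y)) (m : mset X) : Prop :=
  forall x, sums_to (fun y => l (x, y)) (m x).
Definition proj2_is {X Y} (l : mset (X * Y)) (m : mset Y) : Prop :=
  forall y, sums_to (fun x => l (x, y)) (m y).

Definition sp_bisimulation {Act} (N1 N2 : PetriNet Act)
    (B : linking N1 N2 -> Prop) : Prop :=
  (forall (c l : linking N1 N2) (t1 : trans N1),
     mle c l -> B l -> proj1_is c (pre t1) ->
     exists (t2 : trans N2) (c' : linking N1 N2),
       label t2 = label t1 /\ proj2_is c (pre t2) /\
       proj1_is c' (post t1) /\ proj2_is c' (post t2) /\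
       B (madd (msub l c) c'))
  /\
  (forall (c l : linking N1 N2) (t2 : trans N2),
     mle c l -> B l -> proj2_is c (pre t2) ->
     exists (t1 : trans N1) (c' : linking N1 N2),
       label t2 = label t1 /\ proj1_is c (pre t1) /\
       proj1_is c' (post t1) /\ proj2_is c' (post t2) /\
       B (madd (msub l c) c')).

Definition sp_bisimilar {Act} (N1 N2 : PetriNet Act) : Prop :=
  (forall a, type N1 a <-> type N2 a) /\
  exists B : linking N1 N2 -> Prop,
    sp_bisimulation B /\
    exists l, B l /\ proj1_is l (init N1) /\ proj2_is l (init N2).

Section Operators.
Context {Act : Type}.

(* [None] is the fresh place, respectively the fresh transition. *)
Section Prefix.
Variables (a : Act) (N : PetriNet Act).

Definition prefix_old (m : mset (place N)) : mset (option (place N)) :=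
  fun s => match s with Some s => m s | None => 0 end.
Definition prefix_start : mset (option (place N)) :=
  fun s => match s with Some _ => 0 | None => 1 end.

Definition prefix_type (b : Act) : Prop := type N b \/ b = a.

Definition prefix_label (t : option (trans N)) : Act :=
  match t with Some t => label t | None => a end.

Lemma prefix_label_type t : prefix_type (prefix_label t).
Proof.
destruct t as [t|]; [left; apply label_type | right; reflexivity].
Qed.

Definition prefix : PetriNet Act := {|
  place := option (place N);
  trans := option (trans N);
  pre := fun t => match t with
                  | Some t => prefix_old (pre t)
                  | None => prefix_start
                  end;
  post := fun t => match t with
                   | Some t => prefix_old (post t)
                   | None => prefix_old (init N)
                   end;
  init := prefix_start;
  type := prefix_type;
  label := prefix_label;
  label_type := prefix_label_type
|}.
End Prefix.

Section Relabel.
Variables (R : Act -> Act -> Prop) (N : PetriNet Act).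

Definition relabel_type (b : Act) : Prop := exists a, type N a /\ R a b.

Definition relabel_trans : Type := {tb : trans N * Act | R (label (fst tb)) (snd tb)}.

Definition relabel_label (t : relabel_trans) : Act := snd (proj1_sig t).

Lemma relabel_label_type t : relabel_type (relabel_label t).
Proof.
destruct t as [[t b] H]; exists (label t); split; [apply label_type | exact H].
Qed.

Definition relabel : PetriNet Act := {|
  place := place N;
  trans := relabel_trans;
  pre := fun t => pre (fst (proj1_sig t));
  post := fun t => post (fst (proj1_sig t));
  init := init N;
  type := relabel_type;
  label := relabel_label;
  label_type := relabel_label_type
|}.
End Relabel.

Section Binary.
Variables N1 N2 : PetriNet Act.

Definition union_type (b : Act) : Prop := type N1 b \/ type N2 b.
Definition sync_type (b : Act) : Prop := type N1 b /\ type N2 b.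

Inductive par_trans : Type :=
| par_left (t1 : trans N1) (_ : ~ sync_type (label t1))
| par_right (t2 : trans N2) (_ : ~ sync_type (label t2))
| par_sync (t1 : trans N1) (t2 : trans N2)
    (_ : label t1 = label t2) (_ : sync_type (label t1)).

Arguments par_left : clear implicits.
Arguments par_right : clear implicits.
Arguments par_sync : clear implicits.

Definition par_pre (t : par_trans) : mset (place N1 + place N2) :=
  match t with
  | par_left t1 _ => mdisj (pre t1) mempty
  | par_right t2 _ => mdisj mempty (pre t2)
  | par_sync t1 t2 _ _ => mdisj (pre t1) (pre t2)
  end.

Definition par_post (t : par_trans) : mset (place N1 + place N2) :=
  match t with
  | par_left t1 _ => mdisj (post t1) mempty
  | par_right t2 _ => mdisj mempty (post t2)
  | par_sync t1 t2 _ _ => mdisj (post t1) (post t2)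
  end.

Definition par_label (t : par_trans) : Act :=
  match t with
  | par_left t1 _ => label t1
  | par_right t2 _ => label t2
  | par_sync t1 _ _ _ => label t1
  end.

Lemma par_label_type t : union_type (par_label t).
Proof.
destruct t as [t1 Ht | t2 Ht | t1 t2 He Hs];
  [left | right | left]; apply label_type.
Qed.

Definition par : PetriNet Act := {|
  place := place N1 + place N2;
  trans := par_trans;
  pre := par_pre;
  post := par_post;
  init := mdisj (init N1) (init N2);
  type := union_type;
  label := par_label;
  label_type := par_label_type
|}.

(* [choice] below is the intended operator when both initial markings are
   nonempty plain sets; [start_place] is then the set [init N1 * init N2]. *)
Definition start_place : Type := (elem (init N1) * elem (init N2))%type.

Definition on_start (m : mset (place N1 * place N2)) : mset start_place :=
  fun p => m (proj1_sig (fst p), proj1_sig (snd p)).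

Definition choice_mark (m1 : mset (place N1)) (m2 : mset (place N2))
    (m : mset (place N1 * place N2)) :
    mset ((place N1 + place N2) + start_place) :=
  mdisj (mdisj m1 m2) (on_start m).

Definition initial_part {N : PetriNet Act} (t : trans N) (K : mset (place N)) : Prop :=
  nonempty K /\ mle K (mcap (pre t) (init N)).

Inductive choice_trans : Type :=
| choice_old1 (t1 : trans N1)
| choice_old2 (t2 : trans N2)
| choice_new1 (t1 : trans N1) (K : mset (place N1)) (_ : initial_part t1 K)
| choice_new2 (t2 : trans N2) (K : mset (place N2)) (_ : initial_part t2 K).

Arguments choice_new1 : clear implicits.
Arguments choice_new2 : clear implicits.

Definition choice_pre (t : choice_trans) : mset ((place N1 + place N2) + start_place) :=
  match t with
  | choice_old1 t1 => choice_mark (pre t1) mempty mempty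
  | choice_old2 t2 => choice_mark mempty (pre t2) mempty
  | choice_new1 t1 K _ => choice_mark (msub (pre t1) K) mempty (mprod K (init N2))
  | choice_new2 t2 K _ => choice_mark mempty (msub (pre t2) K) (mprod (init N1) K)
  end.

Definition choice_post (t : choice_trans) : mset ((place N1 + place N2) + start_place) :=
  match t with
  | choice_old1 t1 | choice_new1 t1 _ _ => choice_mark (post t1) mempty mempty
  | choice_old2 t2 | choice_new2 t2 _ _ => choice_mark mempty (post t2) mempty
  end.

Definition choice_label (t : choice_trans) : Act :=
  match t with
  | choice_old1 t1 | choice_new1 t1 _ _ => label t1
  | choice_old2 t2 | choice_new2 t2 _ _ => label t2
  end.

Lemma choice_label_type t : union_type (choice_label t).
Proof.
destruct t as [t1 | t2 | t1 K HK | t2 K HK];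
  [left | right | left | right]; apply label_type.
Qed.

Definition choice : PetriNet Act := {|
  place := (place N1 + place N2) + start_place;
  trans := choice_trans;
  pre := choice_pre;
  post := choice_post;
  init := choice_mark mempty mempty (mprod (init N1) (init N2));
  type := union_type;
  label := choice_label;
  label_type := choice_label_type
|}.
End Binary.
End Operators.

(* Main.v *)
(* For each operator, linkings of the compound nets are assembled from linkings in
   the given sp-bisimulations, and every clause of the definition is inherited
   from a component. Swapping the coordinates of linkings makes the two clauses
   mirror images, so only one has to be checked.

   For the choice, let l0 and r0 link the initial markings on the left and on the
   right. The start places are initially linked by the product l0 x r0, and in
   general by k x k' with k <= l0 and k' <= r0, where l + k and r + k' must lie in
   the given bisimulations when l and r link the ordinary places. As the initial
   markings are plain, a fragment of k x k' that projects to K x (initial marking)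
   has the form d x r0, where d <= k projects to K. Replacing this fragment by d
   turns a firing of t^K into a firing of t in the component; the matching
   transition u of the component then yields u^K', with K' the other projection
   of d. *)
From Stdlib Require Import Arith List FinFun Permutation Lia.
From Stdlib Require Import FunctionalExtensionality ClassicalEpsilon.
Require Import Defs.

Set Implicit Arguments.
Unset Strict Implicit.
Unset Printing Implicit Defensive.

(** Names such as [p0], [o0] and [s0] in later scripts are those that [destruct] gives to the
    components of the pair. *)
Ltac mext :=
  extensionality p; repeat match goal with x : (_ * _)%type |- _ => destruct x end.

(** * Sums of families of natural numbers *)

Lemma list_sum_map_add X (f g : X -> nat) s :
  list_sum (map (fun x => f x + g x) s) = list_sum (map f s) + list_sum (map g s).
Proof. induction s; simpl; lia. Qed.

Lemma list_sum_map_le X (f g : X -> nat) s :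
  (forall x, f x <= g x) -> list_sum (map f s) <= list_sum (map g s).
Proof. intro H; induction s as [|x s IH]; simpl; [lia | specialize (H x); lia]. Qed.

Lemma list_sum_map_ge X (f : X -> nat) s x :
  In x s -> f x <= list_sum (map f s).
Proof.
induction s as [|y s IH]; simpl; [easy|].
intros [->|H]; [lia | specialize (IH H); lia].
Qed.

(** A list witnessing [sums_to] may contain points where [f] vanishes. Removing them leaves exactly
    the support, which makes two witnesses comparable. *)
Lemma list_sum_map_filter X (f : X -> nat) s :
  list_sum (map f (filter (fun x => negb (f x =? 0)) s)) = list_sum (map f s).
Proof.
induction s as [|x s IH]; simpl; [easy|].
destruct (Nat.eqb_spec (f x) 0); simpl; lia.
Qed.

(** Without the zeros of [f], both lists enumerate the support without repetition, so each is a
    permutation of the other. *)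
Lemma sums_to_list X (f : X -> nat) n s :
  sums_to f n -> NoDup s -> (forall x, f x <> 0 -> In x s) ->
  list_sum (map f s) = n.
Proof.
intros [s' [Hs' [Hf <-]]] Hs Hf'.
rewrite <- (list_sum_map_filter f s), <- (list_sum_map_filter f s').
apply Permutation_list_sum, Permutation_map, NoDup_Permutation;
  try (apply NoDup_filter; assumption).
intro x; rewrite !filter_In.
destruct (Nat.eqb_spec (f x) 0) as [E|E]; simpl;
  [split; intros [_ ?]; discriminate | firstorder].
Qed.

Lemma sums_to_unique X (f : X -> nat) n m : sums_to f n -> sums_to f m -> n = m.
Proof.
intros Hn [s [Hs [Hf <-]]]; symmetry; exact (sums_to_list Hn Hs Hf).
Qed.

Lemma sums_to_const0 X : sums_to (fun _ : X => 0) 0.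
Proof. exists nil; split; [constructor | easy]. Qed.

Lemma sums_to_ge X (f : X -> nat) n x : sums_to f n -> f x <= n.
Proof.
intros [s [_ [Hf <-]]].
destruct (Nat.eq_dec (f x) 0) as [E|E]; [lia|].
apply list_sum_map_ge; auto.
Qed.

Lemma sums_to_le X (f g : X -> nat) n :
  (forall x, f x <= g x) -> sums_to g n -> exists m, m <= n /\ sums_to f m.
Proof.
intros H [s [Hs [Hg <-]]].
exists (list_sum (map f s)); split; [now apply list_sum_map_le|].
exists s; repeat split; auto.
intros x Hx; apply Hg; specialize (H x); lia.
Qed.

Lemma sums_to_add X (f g : X -> nat) n m :
  sums_to f n -> sums_to g m -> sums_to (fun x => f x + g x) (n + m).
Proof.
intros Hf Hg.
pose proof Hf as [s [_ [Is _]]]; pose proof Hg as [u [_ [Iu _]]].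
(* The union of the two supports is listed without duplicates; this needs an equality test on [X],
   which classical logic supplies. *)
set (dec := fun x y : X => excluded_middle_informative (x = y)).
assert (ND : NoDup (nodup dec (s ++ u))) by apply NoDup_nodup.
assert (I : forall x, f x <> 0 \/ g x <> 0 -> In x (nodup dec (s ++ u))).
{ intros x H; apply nodup_In, in_or_app; destruct H; auto. }
exists (nodup dec (s ++ u)); split; [exact ND|]; split.
- intros x Hx; apply I; lia.
- rewrite list_sum_map_add; f_equal; apply sums_to_list; auto.
Qed.

(** The difference is dominated by [g], so it has some finite sum [k]; additivity and uniqueness of
    sums then give [m = k + n]. *)
Lemma sums_to_sub X (f g : X -> nat) n m :
  (forall x, f x <= g x) -> sums_to f n -> sums_to g m ->
  sums_to (fun x => g x - f x) (m - n).
Proof.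
intros H Hf Hg.
destruct (@sums_to_le _ (fun x => g x - f x) g m) as [k [_ Hk]];
  [intro; lia | exact Hg |].
replace (m - n) with k; [exact Hk|].
assert (E : m = k + n); [|lia].
apply (sums_to_unique Hg).
replace g with (fun x => g x - f x + f x); [now apply sums_to_add|].
extensionality x; specialize (H x); lia.
Qed.

(** The difference of the two families sums to 0. This is how rows of linkings are recognised as
    full. *)
Lemma sums_to_le_eq X (f g : X -> nat) n :
  (forall x, f x <= g x) -> sums_to f n -> sums_to g n -> forall x, f x = g x.
Proof.
intros H Hf Hg x.
pose proof (sums_to_ge x (sums_to_sub H Hf Hg)) as E; simpl in E.
specialize (H x); lia.
Qed.

Lemma map_preimage X Y (h : X -> Y) s :
  (forall y, In y s -> exists x, h x = y) -> exists s', map h s' = s.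
Proof.
induction s as [|y s IH]; intro H; [now exists nil|].
destruct (H y) as [x Hx]; [now left|].
destruct IH as [s' Hs']; [intros; apply H; now right|].
exists (x :: s'); simpl; congruence.
Qed.

(** Reindexing along an injection whose image contains the support. It serves the embeddings [Some],
    [inl], [inr], the inclusion of [elem M], and the exchange of coordinates. *)
Lemma sums_to_image X Y (h : X -> Y) (g : Y -> nat) n :
  Injective h -> (forall y, g y <> 0 -> exists x, h x = y) ->
  sums_to (fun x => g (h x)) n <-> sums_to g n.
Proof.
intros Hh Hg; split; intros [s [Hs [Is <-]]].
- exists (map h s); split; [now apply Injective_map_NoDup|]; split.
  + intros y Hy; destruct (Hg y Hy) as [x <-]; apply in_map; auto.
  + now rewrite map_map.
(* Only points where [g] is nonzero are known to have a preimage, so the zeros are filtered out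
   first. *)
- destruct (@map_preimage _ _ h (filter (fun y => negb (g y =? 0)) s))
    as [s' Hs'].
  { intros y Hy; apply filter_In in Hy; destruct Hy as [_ Hy].
    apply Hg; intro E; rewrite E in Hy; discriminate. }
  exists s'; split; [|split].
  + apply (NoDup_map_inv h); rewrite Hs'; now apply NoDup_filter.
  + intros x Hx.
    assert (H : In (h x) (map h s')).
    { rewrite Hs'; apply filter_In; split; [auto|].
      now apply Bool.negb_true_iff, Nat.eqb_neq. }
    apply in_map_iff in H; destruct H as [x' [E H]]; now rewrite <- (Hh _ _ E).
  + rewrite <- (map_map h g), Hs'; apply list_sum_map_filter.
Qed.

Lemma NoDup_list_prod X Y (s : list X) (u : list Y) :
  NoDup s -> NoDup u -> NoDup (list_prod s u).
Proof.
intros Hs Hu; induction Hs as [|x s Hx Hs IH]; simpl; [constructor|].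
apply NoDup_app; [|exact IH|].
- apply Injective_map_NoDup; [|exact Hu]; intros ? ?; congruence.
- intros [x' y] H1 H2; apply in_map_iff in H1; destruct H1 as [? [[= <- <-] _]].
  apply in_prod_iff in H2; tauto.
Qed.

Lemma list_sum_list_prod X Y (f : X -> nat) (g : Y -> nat) s u :
  list_sum (map (fun p => f (fst p) * g (snd p)) (list_prod s u)) =
  list_sum (map f s) * list_sum (map g u).
Proof.
induction s as [|x s IH]; simpl; [easy|].
rewrite map_app, list_sum_app, IH, map_map; simpl.
replace (list_sum (map (fun y => f x * g y) u)) with (f x * list_sum (map g u));
  [lia|].
clear; induction u; simpl; lia.
Qed.

Lemma sums_to_mul X Y (f : X -> nat) (g : Y -> nat) n m :
  sums_to f n -> sums_to g m ->
  sums_to (fun p => f (fst p) * g (snd p)) (n * m).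
Proof.
intros [s [Hs [Is <-]]] [u [Hu [Iu <-]]].
exists (list_prod s u); split; [now apply NoDup_list_prod|]; split.
- intros [x y] H; simpl in H; apply in_prod; [apply Is | apply Iu]; nia.
- apply list_sum_list_prod.
Qed.

(** * Projections of linkings *)

(** [proj2_is l] is convertible to [proj1_is (flip l)], so facts about second projections are read
    off from those about first ones. *)
Definition flip X Y (l : mset (X * Y)) : mset (Y * X) := fun p => l (snd p, fst p).

Lemma flip_flip X Y (l : mset (X * Y)) : flip (flip l) = l.
Proof. now mext. Qed.

Section Projections.
Context {X Y : Type}.
Implicit Types (c l : mset (X * Y)) (m n : mset X).

Lemma proj1_madd c l m n :
  proj1_is c m -> proj1_is l n -> proj1_is (madd c l) (madd m n).
Proof. intros Hc Hl x; apply sums_to_add; [apply Hc | apply Hl]. Qed.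

Lemma proj1_msub c l m n :
  mle c l -> proj1_is c m -> proj1_is l n -> proj1_is (msub l c) (msub n m).
Proof.
intros H Hc Hl x; apply sums_to_sub; [intro; apply H | apply Hc | apply Hl].
Qed.

Lemma proj1_mempty : proj1_is (@mempty (X * Y)) mempty.
Proof. intro x; apply sums_to_const0. Qed.

Lemma proj1_mempty_inv c : proj1_is c mempty -> c = mempty.
Proof.
intro H; mext; pose proof (sums_to_ge y (H x)) as E.
unfold mempty in *; lia.
Qed.

Lemma proj1_ge l m x y : proj1_is l m -> l (x, y) <= m x.
Proof. intro H; exact (sums_to_ge y (H x)). Qed.

(** Each row of [c] is dominated by a row of [l] and thus has a finite sum; indefinite description
    collects these sums into one multiset. *)
Lemma proj1_mle c l n :
  mle c l -> proj1_is l n -> exists m, mle m n /\ proj1_is c m.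
Proof.
intros H Hl.
assert (E : forall x, exists k, k <= n x /\ sums_to (fun y => c (x, y)) k).
{ intro x; apply sums_to_le with (g := fun y => l (x, y));
    [intro; apply H | apply Hl]. }
exists (fun x => proj1_sig (constructive_indefinite_description _ (E x))).
split; intro x; destruct (constructive_indefinite_description _ (E x)); simpl; tauto.
Qed.

End Projections.

Lemma proj2_mempty X Y : proj2_is (@mempty (X * Y)) mempty.
Proof. intro y; apply sums_to_const0. Qed.

(** * Simulations *)

Definition sp_simulation Act (N1 N2 : PetriNet Act) (B : linking N1 N2 -> Prop) : Prop :=
  forall (c l : linking N1 N2) (t1 : trans N1),
    mle c l -> B l -> proj1_is c (pre t1) ->
    exists (t2 : trans N2) (c' : linking N1 N2),
      label t2 = label t1 /\ proj2_is c (pre t2) /\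
      proj1_is c' (post t1) /\ proj2_is c' (post t2) /\
      B (madd (msub l c) c').

Definition converse Act (N1 N2 : PetriNet Act) (B : linking N1 N2 -> Prop) :
  linking N2 N1 -> Prop := fun l => B (flip l).

(** Flipping [c], [l] and [c'] turns the second clause into the first one for the converse relation,
    since [flip] commutes with [madd] and [msub]. *)
Lemma sp_bisimulation_iff Act (N1 N2 : PetriNet Act) (B : linking N1 N2 -> Prop) :
  sp_bisimulation B <-> sp_simulation B /\ sp_simulation (converse B).
Proof.
split; intros [H1 H2]; (split; [exact H1|]).
- intros c l t2 Hc Hl Hp.
  destruct (H2 (flip c) (flip l) t2) as [t1 [c' [H3 [H4 [H5 [H6 H7]]]]]];
    [intro; apply Hc | exact Hl | exact Hp |].
  exists t1, (flip c'); repeat split; auto.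
  unfold converse.
  replace (flip _) with (madd (msub (flip l) (flip c)) c'); [exact H7 | now mext].
- intros c l t2 Hc Hl Hp.
  destruct (H2 (flip c) (flip l) t2) as [t1 [c' [H3 [H4 [H5 [H6 H7]]]]]];
    [intro; apply Hc | unfold converse; now rewrite flip_flip | exact Hp |].
  exists t1, (flip c'); repeat split; auto.
  replace (madd _ _) with (flip (madd (msub (flip l) (flip c)) c'));
    [exact H7 | now mext].
Qed.

Lemma sp_simulation_iff Act (N1 N2 : PetriNet Act) (B B' : linking N1 N2 -> Prop) :
  (forall l, B l <-> B' l) -> sp_simulation B -> sp_simulation B'.
Proof.
intros E H c l t1 Hc Hl Hp; apply E in Hl.
destruct (H c l t1 Hc Hl Hp) as [t2 [c' H']].
exists t2, c'; rewrite <- E; exact H'.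
Qed.

(** * Prefixing *)

Section OptionLinkings.
Context {X Y : Type}.

(** In the simulation for prefixing, [n = 1] describes the situation before the prefix action and
    [n = 0] the one after it. *)
Definition olink (n : nat) (l : mset (X * Y)) : mset (option X * option Y) :=
  fun p => match p with
           | (Some x, Some y) => l (x, y)
           | (None, None) => n
           | _ => 0
           end.

(** Up to conversion, [omark 0] is [prefix_old] and [omark 1 mempty] is [prefix_start], so one
    projection lemma covers both. *)
Definition omark (n : nat) (m : mset X) : mset (option X) :=
  fun s => match s with Some x => m x | None => n end.

Lemma olink_mle_inv n (l : mset (X * Y)) c :
  mle c (olink n l) -> exists k c0, c = olink k c0 /\ k <= n /\ mle c0 l.
Proof.
intro H; exists (c (None, None)), (fun p => c (Some (fst p), Some (snd p))).
split; [|split].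
- mext; specialize (H (o, o0)); destruct o, o0; simpl in *; lia.
- apply (H (None, None)).
- intros [x y]; apply (H (Some x, Some y)).
Qed.

Lemma olink_madd_msub n k i (l c c' : mset (X * Y)) :
  madd (msub (olink n l) (olink k c)) (olink i c') =
  olink (n - k + i) (madd (msub l c) c').
Proof. now mext; destruct o, o0. Qed.

Lemma sums_to_single Z (f : Z -> nat) z n :
  (forall y, f y <> 0 -> y = z) -> sums_to f n <-> f z = n.
Proof.
intro H.
assert (E : sums_to f (f z)).
{ exists (z :: nil); simpl; split; [repeat constructor; easy|].
  split; [|lia]; intros y Hy; left; symmetry; auto. }
split; [now apply sums_to_unique | now intros <-].
Qed.

(** The row of the fresh place has [n] as its only possibly nonzero entry; every other row is
    reindexed along [Some]. *)
Lemma proj1_olink n k (l : mset (X * Y)) (m : mset X) :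
  proj1_is (olink n l) (omark k m) <-> n = k /\ proj1_is l m.
Proof.
assert (HN : sums_to (fun y => olink n l (None, y)) k <-> n = k).
{ apply (@sums_to_single _ (fun y => olink n l (None, y)) None).
  intros [y|] Hy; [now destruct Hy | easy]. }
assert (HS : forall x, sums_to (fun y => olink n l (Some x, y)) (m x) <->
                       sums_to (fun y => l (x, y)) (m x)).
{ intro x; symmetry.
  apply (@sums_to_image _ _ (@Some Y) (fun y => olink n l (Some x, y)));
    [intros ? ?; congruence | intros [y|] Hy; [now exists y | now destruct Hy]]. }
split.
- intro H; split; [exact (proj1 HN (H None))|].
  intro x; exact (proj1 (HS x) (H (Some x))).
- intros [E H] [x|]; [exact (proj2 (HS x) (H x)) | exact (proj2 HN E)].
Qed.
End OptionLinkings.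

Lemma flip_olink X Y n (l : mset (X * Y)) : flip (olink n l) = olink n (flip l).
Proof. now mext; destruct o, o0. Qed.

Lemma flip_eq_olink X Y n (l : mset (option X * option Y)) (l' : mset (Y * X)) :
  flip l = olink n l' -> l = olink n (flip l').
Proof. intro E; now rewrite <- flip_olink, <- E, flip_flip. Qed.

Lemma proj2_olink X Y n k (l : mset (X * Y)) m :
  proj2_is (olink n l) (omark k m) <-> n = k /\ proj2_is l m.
Proof.
change (proj1_is (flip (olink n l)) (omark k m) <-> n = k /\ proj1_is (flip l) m).
rewrite flip_olink; apply proj1_olink.
Qed.

Section Prefix.
Context {Act : Type}.

(* A transition with empty preset can fire before the prefix action does.
   Such firings, and what they trigger, are recorded in [e] and replayed on
   top of the initial linking [l0] in [B]. *)
Definition prefix_linkings a (N1 N2 : PetriNet Act) (B : linking N1 N2 -> Prop)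
    (l0 : linking N1 N2) (L : linking (prefix a N1) (prefix a N2)) : Prop :=
  (exists l, B l /\ L = olink 0 l) \/
  (exists e, B (madd l0 e) /\ L = olink 1 e).

Lemma prefix_linkings_simulation a (N1 N2 : PetriNet Act)
    (B : linking N1 N2 -> Prop) (l0 : linking N1 N2) :
  sp_simulation B -> proj1_is l0 (init N1) -> proj2_is l0 (init N2) ->
  sp_simulation (prefix_linkings (a := a) B l0).
Proof.
intros HB P1 P2 c L t Hc HL Hp.
assert (exists n l, L = olink n l) as [n [l E]].
{ destruct HL as [[l [_ E]]|[l [_ E]]]; eauto. }
subst L.
destruct (olink_mle_inv Hc) as [k [c0 [-> [Hk Hc0]]]].
destruct t as [t|].
- change (proj1_is (olink k c0) (omark 0 (pre t))) in Hp.
  apply proj1_olink in Hp; destruct Hp as [-> Hp].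
  destruct HL as [[l' [Hl E]]|[e [He E]]].
  + assert (l' = l) as ->.
    { mext; exact (f_equal (fun f => f (Some p, Some p0)) (eq_sym E)). }
    assert (n = 0) as -> by exact (f_equal (fun f => f (None, None)) E).
    destruct (HB c0 l t Hc0 Hl Hp) as [t2 [c' [H1 [H2 [H3 [H4 H5]]]]]].
    exists (Some t2), (olink 0 c').
    split; [exact H1|]; split; [now apply (proj2_olink 0 0)|].
    split; [now apply (proj1_olink 0 0)|]; split; [now apply (proj2_olink 0 0)|].
    left; exists (madd (msub l c0) c'); split; [exact H5 | apply olink_madd_msub].
  + assert (e = l) as ->.
    { mext; exact (f_equal (fun f => f (Some p, Some p0)) (eq_sym E)). }
    assert (n = 1) as -> by exact (f_equal (fun f => f (None, None)) E).
    (* Before the prefix action, the firing is replayed in [B] with the initial links [l0] as an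
       untouched context. *)
    assert (Hc1 : mle c0 (madd l0 l)).
    { intro x; specialize (Hc0 x); unfold madd; lia. }
    destruct (HB c0 _ t Hc1 He Hp) as [t2 [c' [H1 [H2 [H3 [H4 H5]]]]]].
    exists (Some t2), (olink 0 c').
    split; [exact H1|]; split; [now apply (proj2_olink 0 0)|].
    split; [now apply (proj1_olink 0 0)|]; split; [now apply (proj2_olink 0 0)|].
    right; exists (madd (msub l c0) c').
    split; [|apply olink_madd_msub].
    replace (madd l0 _) with (madd (msub (madd l0 l) c0) c'); [exact H5|].
    extensionality p; specialize (Hc0 p); unfold madd, msub; lia.
- change (proj1_is (olink k c0) (omark 1 mempty)) in Hp.
  apply proj1_olink in Hp; destruct Hp as [-> Hp].
  apply proj1_mempty_inv in Hp; subst c0.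
  destruct HL as [[l' [_ E]]|[e [He E]]].
  (* After the prefix action the start places are no longer linked, so the fresh transition cannot
     fire. *)
  + apply (f_equal (fun f => f (None, None))) in E; simpl in E; lia.
  + assert (e = l) as ->.
    { mext; exact (f_equal (fun f => f (Some p, Some p0)) (eq_sym E)). }
    assert (n = 1) as -> by exact (f_equal (fun f => f (None, None)) E).
    (* The prefix actions produce the two initial markings, linked by [l0]; together with the
       recorded links this is the member of [B] given by [He]. *)
    exists None, (olink 0 l0).
    split; [reflexivity|].
    split; [apply (proj2_olink 1 1); split; [easy | apply proj2_mempty]|].
    split; [now apply (proj1_olink 0 0)|]; split; [now apply (proj2_olink 0 0)|].
    left; exists (madd (msub l mempty) l0); split; [|apply olink_madd_msub].
    replace (madd _ l0) with (madd l0 l); [exact He|].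
    extensionality p; unfold madd, msub, mempty; lia.
Qed.

(** With this, the second half of the bisimulation is the simulation lemma for [converse B] and
    [flip l0]. *)
Lemma prefix_linkings_converse a (N1 N2 : PetriNet Act)
    (B : linking N1 N2 -> Prop) (l0 : linking N1 N2) L :
  prefix_linkings (a := a) (converse B) (flip l0) L <->
  converse (prefix_linkings (a := a) B l0) L.
Proof.
split.
- intros [[l [Hl ->]]|[e [He ->]]].
  + left; exists (flip l); split; [exact Hl | apply flip_olink].
  + right; exists (flip e); split; [|apply flip_olink].
    replace (madd l0 (flip e)) with (flip (madd (flip l0) e)); [exact He | now mext].
- intros [[l [Hl E]]|[e [He E]]]; apply flip_eq_olink in E; subst L.
  + left; exists (flip l); split; [|reflexivity].
    unfold converse; now rewrite flip_flip.
  + right; exists (flip e); split; [|reflexivity].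
    unfold converse; replace (flip _) with (madd l0 e); [exact He | now mext].
Qed.

Lemma sp_bisimilar_prefix a (N1 N2 : PetriNet Act) :
  sp_bisimilar N1 N2 -> sp_bisimilar (prefix a N1) (prefix a N2).
Proof.
intros [HA [B [HB [l0 [Hl0 [P1 P2]]]]]]; split.
- intro b; simpl; unfold prefix_type; now rewrite HA.
- apply sp_bisimulation_iff in HB; destruct HB as [HB HB'].
  exists (prefix_linkings (a := a) B l0); split.
  + apply sp_bisimulation_iff; split; [now apply prefix_linkings_simulation|].
    apply (sp_simulation_iff (prefix_linkings_converse (a := a) B l0)).
    now apply prefix_linkings_simulation.
  + exists (olink 1 mempty); split; [|split].
    * right; exists mempty; split; [|easy].
      replace (madd l0 mempty) with l0; [exact Hl0|].
      extensionality p; unfold madd, mempty; lia.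
    * apply (proj1_olink 1 1); split; [easy | apply proj1_mempty].
    * apply (proj2_olink 1 1); split; [easy | apply proj2_mempty].
Qed.

(** * Relabelling *)

(** Places, presets and postsets are unchanged, so [B] itself works; the matching transition can
    take the same new label [b] because the old labels agree. *)
Lemma relabel_simulation (R : Act -> Act -> Prop) (N1 N2 : PetriNet Act)
    (B : linking N1 N2 -> Prop) :
  sp_simulation B -> @sp_simulation _ (relabel R N1) (relabel R N2) B.
Proof.
intros HB c l [[t b] Ht] Hc Hl Hp; simpl in *.
destruct (HB c l t Hc Hl Hp) as [t2 [c' [H1 H2]]].
assert (Ht2 : R (label (fst (t2, b))) (snd (t2, b))) by (simpl; now rewrite H1).
exists (exist _ (t2, b) Ht2), c'; now split.
Qed.

Lemma sp_bisimilar_relabel (R : Act -> Act -> Prop) (N1 N2 : PetriNet Act) :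
  sp_bisimilar N1 N2 -> sp_bisimilar (relabel R N1) (relabel R N2).
Proof.
intros [HA [B [HB Hl0]]]; split.
- intro b; split; intros [a [H1 H2]]; exists a; split; auto; now apply HA.
- exists B; split; [|exact Hl0].
  apply sp_bisimulation_iff in HB; apply sp_bisimulation_iff.
  split; apply relabel_simulation; tauto.
Qed.
End Prefix.

(** * Parallel composition *)

Section Join.
Context {X1 X2 Y1 Y2 : Type}.

Definition join (l : mset (X1 * X2)) (r : mset (Y1 * Y2)) :
    mset ((X1 + Y1) * (X2 + Y2)) :=
  fun p => match p with
           | (inl x1, inl x2) => l (x1, x2)
           | (inr y1, inr y2) => r (y1, y2)
           | _ => 0
           end.

(** Links between the two sides are absent from [join l r], hence from everything below it. *)
Lemma join_mle_inv l r c :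
  mle c (join l r) -> exists a b, c = join a b /\ mle a l /\ mle b r.
Proof.
intro H.
exists (fun p => c (inl (fst p), inl (snd p))), (fun p => c (inr (fst p), inr (snd p))).
split; [|split].
- mext; specialize (H (s, s0)); destruct s, s0; simpl in *; lia.
- intros [x y]; apply (H (inl x, inl y)).
- intros [x y]; apply (H (inr x, inr y)).
Qed.

Lemma join_madd_msub l r a b a' b' :
  madd (msub (join l r) (join a b)) (join a' b') =
  join (madd (msub l a) a') (madd (msub r b) b').
Proof. now mext; destruct s, s0. Qed.

Lemma proj1_join l r m n :
  proj1_is (join l r) (mdisj m n) <-> proj1_is l m /\ proj1_is r n.
Proof.
assert (HL : forall x, sums_to (fun y => join l r (inl x, y)) (m x) <->
                       sums_to (fun y => l (x, y)) (m x)).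
{ intro x; symmetry.
  apply (@sums_to_image _ _ (@inl X2 Y2) (fun y => join l r (inl x, y)));
    [intros ? ?; congruence | intros [y|y] Hy; [now exists y | now destruct Hy]]. }
assert (HR : forall x, sums_to (fun y => join l r (inr x, y)) (n x) <->
                       sums_to (fun y => r (x, y)) (n x)).
{ intro x; symmetry.
  apply (@sums_to_image _ _ (@inr X2 Y2) (fun y => join l r (inr x, y)));
    [intros ? ?; congruence | intros [y|y] Hy; [now destruct Hy | now exists y]]. }
split.
- intro H; split; intro x; [apply HL, (H (inl x)) | apply HR, (H (inr x))].
- intros [H1 H2] [x|x]; [apply HL, H1 | apply HR, H2].
Qed.
End Join.

Lemma flip_join X1 X2 Y1 Y2 (l : mset (X1 * X2)) (r : mset (Y1 * Y2)) :
  flip (join l r) = join (flip l) (flip r).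
Proof. now mext; destruct s, s0. Qed.

Lemma flip_eq_join X1 X2 Y1 Y2 (L : mset ((X2 + Y2) * (X1 + Y1)))
    (l : mset (X1 * X2)) (r : mset (Y1 * Y2)) :
  flip L = join l r -> L = join (flip l) (flip r).
Proof. intro E; now rewrite <- flip_join, <- E, flip_flip. Qed.

Lemma proj2_join X1 X2 Y1 Y2 (l : mset (X1 * X2)) (r : mset (Y1 * Y2)) m n :
  proj2_is (join l r) (mdisj m n) <-> proj2_is l m /\ proj2_is r n.
Proof.
change (proj1_is (flip (join l r)) (mdisj m n) <->
        proj1_is (flip l) m /\ proj1_is (flip r) n).
rewrite flip_join; apply proj1_join.
Qed.

Lemma madd_msub_mempty X (l : mset X) : madd (msub l mempty) mempty = l.
Proof. extensionality p; unfold madd, msub, mempty; lia. Qed.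

Section Par.
Context {Act : Type}.

Definition par_linkings (Nl1 Nl2 Nr1 Nr2 : PetriNet Act)
    (Bl : linking Nl1 Nl2 -> Prop) (Br : linking Nr1 Nr2 -> Prop)
    (L : linking (par Nl1 Nr1) (par Nl2 Nr2)) : Prop :=
  exists l r, L = join l r /\ Bl l /\ Br r.

(** Matching preserves labels, and both compositions synchronise on the same labels. Hence local
    transitions are matched by local ones and synchronised pairs by synchronised pairs. *)
Lemma par_linkings_simulation (Nl1 Nl2 Nr1 Nr2 : PetriNet Act)
    (Bl : linking Nl1 Nl2 -> Prop) (Br : linking Nr1 Nr2 -> Prop) :
  (forall b, sync_type Nl1 Nr1 b <-> sync_type Nl2 Nr2 b) ->
  sp_simulation Bl -> sp_simulation Br -> sp_simulation (par_linkings Bl Br).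
Proof.
intros HA HBl HBr c L t Hc [l [r [-> [Hl Hr]]]] Hp.
destruct (join_mle_inv Hc) as [c1 [c2 [-> [Hc1 Hc2]]]].
destruct t as [t1 Ht | t1 Ht | t1 u1 E Ht].
- apply (@proj1_join _ _ _ _ c1 c2 (pre t1) mempty) in Hp; destruct Hp as [Hp1 Hp2].
  (* The transition takes no tokens from the right component, so the fragment is empty there. *)
  apply proj1_mempty_inv in Hp2; subst c2.
  destruct (HBl c1 l t1 Hc1 Hl Hp1) as [t2 [c' [H1 [H2 [H3 [H4 H5]]]]]].
  assert (Ht2 : ~ sync_type Nl2 Nr2 (label t2)) by now rewrite H1, <- HA.
  exists (par_left Ht2), (join c' mempty); split; [exact H1|].
  split; [apply proj2_join; split; [exact H2 | apply proj2_mempty]|].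
  split; [apply proj1_join; split; [exact H3 | apply proj1_mempty]|].
  split; [apply proj2_join; split; [exact H4 | apply proj2_mempty]|].
  exists (madd (msub l c1) c'), r; split; [|now split].
  (* The idle component is written as an update by empty linkings to fit [join_madd_msub]. *)
  rewrite <- (madd_msub_mempty r) at 2; apply join_madd_msub.
- apply (@proj1_join _ _ _ _ c1 c2 mempty (pre t1)) in Hp; destruct Hp as [Hp1 Hp2].
  apply proj1_mempty_inv in Hp1; subst c1.
  destruct (HBr c2 r t1 Hc2 Hr Hp2) as [t2 [c' [H1 [H2 [H3 [H4 H5]]]]]].
  assert (Ht2 : ~ sync_type Nl2 Nr2 (label t2)) by now rewrite H1, <- HA.
  exists (par_right Ht2), (join mempty c'); split; [exact H1|].
  split; [apply proj2_join; split; [apply proj2_mempty | exact H2]|].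
  split; [apply proj1_join; split; [apply proj1_mempty | exact H3]|].
  split; [apply proj2_join; split; [apply proj2_mempty | exact H4]|].
  exists l, (madd (msub r c2) c'); split; [|now split].
  rewrite <- (madd_msub_mempty l) at 2; apply join_madd_msub.
- apply (@proj1_join _ _ _ _ c1 c2 (pre t1) (pre u1)) in Hp; destruct Hp as [Hp1 Hp2].
  destruct (HBl c1 l t1 Hc1 Hl Hp1) as [t2 [c' [H1 [H2 [H3 [H4 H5]]]]]].
  destruct (HBr c2 r u1 Hc2 Hr Hp2) as [u2 [d' [G1 [G2 [G3 [G4 G5]]]]]].
  (* Both matches keep the common label of [t1] and [u1], so they can synchronise as well. *)
  assert (E2 : label t2 = label u2) by congruence.
  assert (Ht2 : sync_type Nl2 Nr2 (label t2)) by now rewrite H1, <- HA.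
  exists (par_sync E2 Ht2), (join c' d'); split; [exact H1|].
  split; [now apply proj2_join|]; split; [now apply proj1_join|].
  split; [now apply proj2_join|].
  exists (madd (msub l c1) c'), (madd (msub r c2) d'); split; [|now split].
  apply join_madd_msub.
Qed.

Lemma par_linkings_converse (Nl1 Nl2 Nr1 Nr2 : PetriNet Act)
    (Bl : linking Nl1 Nl2 -> Prop) (Br : linking Nr1 Nr2 -> Prop) L :
  par_linkings (converse Bl) (converse Br) L <-> converse (par_linkings Bl Br) L.
Proof.
split; intros [l [r [E [Hl Hr]]]].
- exists (flip l), (flip r); subst L; split; [apply flip_join | now split].
- apply flip_eq_join in E; subst L; exists (flip l), (flip r).
  split; [easy|]; unfold converse; now rewrite !flip_flip.
Qed.

Lemma sp_bisimilar_par (Nl1 Nl2 Nr1 Nr2 : PetriNet Act) :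
  sp_bisimilar Nl1 Nl2 -> sp_bisimilar Nr1 Nr2 ->
  sp_bisimilar (par Nl1 Nr1) (par Nl2 Nr2).
Proof.
intros [HAl [Bl [HBl [l0 [Hl0 [P1 P2]]]]]] [HAr [Br [HBr [r0 [Hr0 [Q1 Q2]]]]]].
split; [intro b; simpl; unfold union_type; now rewrite HAl, HAr|].
apply sp_bisimulation_iff in HBl, HBr.
exists (par_linkings Bl Br); split.
- apply sp_bisimulation_iff; split.
  + apply par_linkings_simulation; [|tauto|tauto].
    intro b; unfold sync_type; now rewrite HAl, HAr.
  + apply (sp_simulation_iff (par_linkings_converse Bl Br)).
    apply par_linkings_simulation; [|tauto|tauto].
    intro b; unfold sync_type; now rewrite HAl, HAr.
- exists (join l0 r0); split; [now exists l0, r0|].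
  split; [now apply proj1_join | now apply proj2_join].
Qed.
End Par.

(** * Choice *)

Lemma proj1_mono X Y (c l : mset (X * Y)) m n :
  mle c l -> proj1_is c m -> proj1_is l n -> mle m n.
Proof.
intros H Hc Hl; destruct (proj1_mle H Hl) as [m' [H1 H2]]; intro x.
rewrite (sums_to_unique (Hc x) (H2 x)); apply H1.
Qed.

(** If all column sums were 0, all entries would be 0, and so would all row sums. *)
Lemma proj_nonempty X Y (l : mset (X * Y)) m n :
  proj1_is l m -> proj2_is l n -> nonempty m -> nonempty n.
Proof.
intros Hm Hn [x Hx]; apply NNPP; intro H.
assert (E : (fun y => l (x, y)) = fun _ => 0).
{ extensionality y; pose proof (sums_to_ge x (Hn y)) as L; simpl in L.
  destruct (Nat.eq_dec (n y) 0); [lia|]; exfalso; apply H; exists y; lia. }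
pose proof (Hm x) as S; rewrite E in S.
pose proof (sums_to_unique S (sums_to_const0 Y)); lia.
Qed.

(** * Product linkings between start places *)

Section Tensor.
Context {X1 X2 Y1 Y2 : Type}.
Variables (M1 : mset X1) (M2 : mset X2) (N1 : mset Y1) (N2 : mset Y2).

Definition tensor (k : mset (X1 * X2)) (k' : mset (Y1 * Y2)) :
    mset ((elem M1 * elem N1) * (elem M2 * elem N2)) :=
  fun p => k (proj1_sig (fst (fst p)), proj1_sig (fst (snd p))) *
           k' (proj1_sig (snd (fst p)), proj1_sig (snd (snd p))).

(** Up to conversion this is [on_start (mprod m n)], stated without reference to nets. *)
Definition rect (m : mset X1) (n : mset Y1) : mset (elem M1 * elem N1) :=
  fun p => m (proj1_sig (fst p)) * n (proj1_sig (snd p)).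

(** The membership proof [0 < M x] is an instance of [le], whose proofs are unique. *)
Lemma elem_inj X (M : mset X) : Injective (fun x : elem M => proj1_sig x).
Proof.
intros [x Hx] [y Hy]; simpl; intros <-; f_equal; apply le_unique.
Qed.

Lemma sums_to_elem X (M : mset X) (f : X -> nat) n :
  (forall x, f x <= M x) -> sums_to f n ->
  sums_to (fun x : elem M => f (proj1_sig x)) n.
Proof.
intros H Hf; apply (sums_to_image (g := f) n (@elem_inj X M)); [|exact Hf].
intros x Hx; assert (Hx' : 0 < M x) by (specialize (H x); lia).
now exists (exist _ x Hx').
Qed.

(** Row sums of a product multiply. The bounds by [M2] and [N2] ensure that restricting the columns
    to initially marked places loses nothing. *)
Lemma proj1_tensor k k' m n :
  (forall x y, k (x, y) <= M2 y) -> (forall x y, k' (x, y) <= N2 y) ->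
  proj1_is k m -> proj1_is k' n -> proj1_is (tensor k k') (rect m n).
Proof.
intros Hk Hk' Hm Hn [[x Hx] [y Hy]].
apply (sums_to_mul (f := fun x2 : elem M2 => k (x, proj1_sig x2))
                   (g := fun y2 : elem N2 => k' (y, proj1_sig y2))).
- apply (sums_to_elem (f := fun x2 => k (x, x2))); [apply Hk | apply Hm].
- apply (sums_to_elem (f := fun y2 => k' (y, y2))); [apply Hk' | apply Hn].
Qed.

Lemma tensor_msub_l k c k' :
  msub (tensor k k') (tensor c k') = tensor (msub k c) k'.
Proof. mext; symmetry; apply Nat.mul_sub_distr_r. Qed.

Lemma tensor_msub_r k k' c' :
  msub (tensor k k') (tensor k c') = tensor k (msub k' c').
Proof. mext; symmetry; apply Nat.mul_sub_distr_l. Qed.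

(* Rows of [tensor k k'] sum to at most 1, while those of [c] indexed by
   [K x N1] sum to 1. These rows of [tensor k k'] are therefore full, so [k'] has
   lost nothing of [r0]: only one side of a choice can ever use start places. *)
Lemma tensor_mle_inv_l l0 r0 k k' c K :
  proj1_is l0 M1 -> proj2_is l0 M2 -> proj1_is r0 N1 -> proj2_is r0 N2 ->
  plain M1 -> plain N1 -> nonempty N1 ->
  mle k l0 -> mle k' r0 -> mle c (tensor k k') ->
  nonempty K -> mle K M1 -> proj1_is c (rect K N1) ->
  k' = r0 /\ exists d, mle d k /\ proj1_is d K /\ c = tensor d r0.
Proof.
intros P1 P2 Q1 Q2 HM HN [y0 Hy0] Hk Hk' Hc [x0 Hx0] HK Hp.
destruct (proj1_mle Hk P1) as [m [Hm Pm]].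
destruct (proj1_mle Hk' Q1) as [n [Hn Pn]].
assert (Pt : proj1_is (tensor k k') (rect m n)).
{ apply proj1_tensor; auto; intros x y;
    [apply (Nat.le_trans _ _ _ (Hk _)) | apply (Nat.le_trans _ _ _ (Hk' _))];
    [apply (proj1_ge (l := flip l0) y x P2) | apply (proj1_ge (l := flip r0) y x Q2)]. }
pose proof (proj1_mono Hc Hp Pt) as HKmn.
(* A positive [K x * N1 y] below [m x * n y] makes both factors positive, and plainness bounds them
   by 1. *)
assert (row : forall x y, 0 < K x -> 0 < N1 y -> m x = 1 /\ n y = 1).
{ intros x y Hx Hy.
  assert (Hx' : 0 < M1 x) by (specialize (HK x); lia).
  specialize (HKmn (exist _ x Hx', exist _ y Hy)); unfold rect in HKmn; simpl in HKmn.
  specialize (Hm x); specialize (Hn y); specialize (HM x); specialize (HN y); nia. }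
(* Where [N1] vanishes, so does the row of [r0]. Elsewhere the point [x0] of [K] makes [row]
   applicable, so the rows of [k'] and [r0] both sum to 1 and coincide. *)
assert (Er : k' = r0).
{ extensionality p; destruct p as [y1 y2].
  destruct (Nat.eq_dec (N1 y1) 0) as [E|E].
  - pose proof (proj1_ge y1 y2 Q1); specialize (Hk' (y1, y2)); lia.
  - destruct (@row x0 y1) as [_ E1]; [assumption|lia|].
    apply (@sums_to_le_eq _ (fun y => k' (y1, y)) (fun y => r0 (y1, y)) (N1 y1));
      [intro; apply Hk' | | apply Q1].
    replace (N1 y1) with (n y1); [apply Pn | specialize (HN y1); lia]. }
subst k'; split; [reflexivity|].
(* As [K] takes only the values 0 and 1, the factor selects the rows of [k] indexed by [K]. *)
exists (fun p => K (fst p) * k p); split; [|split].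
- intros [x1 x2]; specialize (HK x1); specialize (HM x1); simpl; nia.
- intro x; simpl.
  destruct (Nat.eq_dec (K x) 0) as [E|E].
  + rewrite E; apply sums_to_const0.
  + assert (K x = 1) as -> by (specialize (HK x); specialize (HM x); lia).
    destruct (@row x y0) as [E1 _]; [lia|assumption|].
    specialize (Pm x); rewrite E1 in Pm.
    replace (fun y => 1 * k (x, y)) with (fun y => k (x, y)); [exact Pm|].
    extensionality y; lia.
- extensionality p; destruct p as [[x y] z]; unfold tensor at 1; simpl.
  destruct (Nat.eq_dec (K (proj1_sig x)) 0) as [E|E].
  + pose proof (proj1_ge (x, y) z Hp) as L; unfold rect in L; simpl in L.
    rewrite E in L |- *; simpl in *; lia.
  + assert (E1 : K (proj1_sig x) = 1)
      by (specialize (HK (proj1_sig x)); specialize (HM (proj1_sig x)); lia).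
    rewrite E1, Nat.mul_1_l.
    destruct (@row (proj1_sig x) (proj1_sig y)) as [E2 E3]; [lia | apply (proj2_sig y) |].
    (* A row of [c] lies below the row of the product, and both sum to 1. *)
    apply (@sums_to_le_eq _ (fun z => c ((x, y), z)) (fun z => tensor k r0 ((x, y), z)) 1);
      [intro; apply Hc | |].
    * replace 1 with (rect K N1 (x, y)); [apply Hp|].
      unfold rect; simpl; rewrite E1.
      pose proof (HN (proj1_sig y)); pose proof (proj2_sig y); simpl in *; lia.
    * replace 1 with (rect m n (x, y)); [apply Pt|].
      unfold rect; simpl; now rewrite E2, E3.
Qed.
End Tensor.

Section TensorSymmetry.
Context {X1 X2 Y1 Y2 : Type}.

Definition swap (c : mset ((X1 * Y1) * (X2 * Y2))) : mset ((Y1 * X1) * (Y2 * X2)) :=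
  fun p => c ((snd (fst p), fst (fst p)), (snd (snd p), fst (snd p))).

Lemma proj1_swap c m :
  proj1_is c m -> proj1_is (swap c) (fun p => m (snd p, fst p)).
Proof.
intros H [y x].
apply (@sums_to_image _ _ (fun p : Y2 * X2 => (snd p, fst p))
         (fun q => c ((x, y), q))).
- intros [? ?] [? ?]; simpl; congruence.
- intros [x2 y2] _; now exists (y2, x2).
- apply H.
Qed.
End TensorSymmetry.

(** Exchanging the two factors by [swap] reduces this to [tensor_mle_inv_l]. *)
Lemma tensor_mle_inv_r X1 X2 Y1 Y2 (M1 : mset X1) (M2 : mset X2) (N1 : mset Y1)
    (N2 : mset Y2) l0 r0 k k' (c : mset ((elem M1 * elem N1) * (elem M2 * elem N2))) K :
  proj1_is l0 M1 -> proj2_is l0 M2 -> proj1_is r0 N1 -> proj2_is r0 N2 ->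
  plain M1 -> plain N1 -> nonempty M1 ->
  mle k l0 -> mle k' r0 -> mle c (tensor k k') ->
  nonempty K -> mle K N1 -> proj1_is c (rect M1 K) ->
  k = l0 /\ exists d, mle d k' /\ proj1_is d K /\ c = tensor l0 d.
Proof.
intros P1 P2 Q1 Q2 HM HN HM0 Hk Hk' Hc HK0 HK Hp.
destruct (@tensor_mle_inv_l _ _ _ _ N1 N2 M1 M2 r0 l0 k' k (swap c) K)
  as [E [d [H1 [H2 H3]]]]; auto.
- intros [[y1 x1] [y2 x2]]; unfold swap; simpl.
  eapply Nat.le_trans; [apply Hc|]; unfold tensor; simpl; lia.
- replace (rect K M1) with (fun p : elem N1 * elem M1 => rect M1 K (snd p, fst p));
    [now apply proj1_swap | mext; apply Nat.mul_comm].
- split; [exact E|]; exists d; split; [|split]; auto.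
  extensionality p; destruct p as [[x1 y1] [x2 y2]].
  pose proof (f_equal (fun f => f ((y1, x1), (y2, x2))) H3) as F.
  unfold swap, tensor in *; simpl in *; lia.
Qed.

Lemma flip_tensor X1 X2 Y1 Y2 (M1 : mset X1) (M2 : mset X2) (N1 : mset Y1)
    (N2 : mset Y2) k k' :
  flip (@tensor _ _ _ _ M1 M2 N1 N2 k k') = tensor (flip k) (flip k').
Proof. now mext. Qed.

Lemma proj2_tensor X1 X2 Y1 Y2 (M1 : mset X1) (M2 : mset X2) (N1 : mset Y1)
    (N2 : mset Y2) k k' m n :
  (forall x y, k (x, y) <= M1 x) -> (forall x y, k' (x, y) <= N1 x) ->
  proj2_is k m -> proj2_is k' n ->
  proj2_is (@tensor _ _ _ _ M1 M2 N1 N2 k k') (rect m n).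
Proof.
intros Hk Hk' Hm Hn.
change (proj1_is (flip (@tensor _ _ _ _ M1 M2 N1 N2 k k')) (rect m n)).
rewrite flip_tensor; apply proj1_tensor; auto; unfold flip; simpl; auto.
Qed.

(** * The sp-bisimulation for choice *)

Section Choice.
Context {Act : Type}.

(** Since [c] takes nothing from [k], removing [c] from [madd l k] leaves [k] intact as a
    context. *)
Lemma sp_simulation_frame (N1 N2 : PetriNet Act) (B : linking N1 N2 -> Prop)
    (l k c : linking N1 N2) (t1 : trans N1) :
  sp_simulation B -> B (madd l k) -> mle c l -> proj1_is c (pre t1) ->
  exists (t2 : trans N2) (c' : linking N1 N2),
    label t2 = label t1 /\ proj2_is c (pre t2) /\
    proj1_is c' (post t1) /\ proj2_is c' (post t2) /\
    B (madd (madd (msub l c) c') k).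
Proof.
intros HB Hl Hc Hp.
destruct (HB c (madd l k) t1) as [t2 [c' [H1 [H2 [H3 [H4 H5]]]]]]; auto.
{ intro p; specialize (Hc p); unfold madd; lia. }
exists t2, c'; repeat split; auto.
replace (madd (madd _ c') k) with (madd (msub (madd l k) c) c'); [exact H5|].
extensionality p; specialize (Hc p); unfold madd, msub; lia.
Qed.

(** The component fires [t1] on [madd c d], where [d] stands for the initial tokens [K1]. The
    matching [K2] is the second projection of [d]; it lies below [init N2] because [d] is below
    [l0]. *)
Lemma sp_simulation_initial_part (N1 N2 : PetriNet Act) (B : linking N1 N2 -> Prop)
    (l0 l k c d : linking N1 N2) (t1 : trans N1) (K1 : mset (place N1)) :
  sp_simulation B -> proj2_is l0 (init N2) -> mle k l0 -> B (madd l k) ->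
  mle c l -> mle d k -> initial_part t1 K1 ->
  proj1_is c (msub (pre t1) K1) -> proj1_is d K1 ->
  exists (t2 : trans N2) (K2 : mset (place N2)) (c' : linking N1 N2),
    initial_part t2 K2 /\ label t2 = label t1 /\
    proj2_is c (msub (pre t2) K2) /\ proj2_is d K2 /\
    proj1_is c' (post t1) /\ proj2_is c' (post t2) /\
    B (madd (madd (msub l c) c') (msub k d)).
Proof.
intros HB P2 Hk Hl Hc Hd [HK0 HK] Hpc Hpd.
destruct (HB (madd c d) (madd l k) t1) as [t2 [c' [H1 [H2 [H3 [H4 H5]]]]]]; auto.
{ intro p; specialize (Hc p); specialize (Hd p); unfold madd; lia. }
{ replace (pre t1) with (madd (msub (pre t1) K1) K1); [now apply proj1_madd|].
  extensionality p; specialize (HK p); unfold madd, msub, mcap in *; lia. }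
destruct (@proj1_mle _ _ (flip d) (flip l0) (init N2)) as [K2 [HK2 Hpd2]]; auto.
{ intro p; eapply Nat.le_trans; [apply Hd | apply Hk]. }
assert (Hdcd : mle (flip d) (flip (madd c d))) by (intro p; unfold flip, madd; lia).
exists t2, K2, c'; split; [split|]; [exact (proj_nonempty Hpd Hpd2 HK0) | |].
{ intro y; apply Nat.min_glb; [|apply HK2].
  exact (proj1_mono (c := flip d) (l := flip (madd c d)) Hdcd Hpd2 H2 y). }
split; [exact H1|]; split; [|repeat split; auto].
- change (proj1_is (flip c) (msub (pre t2) K2)).
  (* The remaining preset of [t2] is linked by [c], which is [madd c d] without [d]. *)
  replace (flip c) with (msub (flip (madd c d)) (flip d)); [now apply proj1_msub|].
  extensionality p; unfold flip, madd, msub; lia.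
- replace (madd _ (msub k d)) with (madd (msub (madd l k) (madd c d)) c'); [exact H5|].
  extensionality p; specialize (Hc p); specialize (Hd p); unfold madd, msub; lia.
Qed.

(* The start places carry [tensor k k']; the parts [k] of [l0] and [k'] of [r0]
   stand for initial tokens not yet consumed on the left and on the right. *)
Definition choice_linkings (Nl1 Nl2 Nr1 Nr2 : PetriNet Act)
    (Bl : linking Nl1 Nl2 -> Prop) (Br : linking Nr1 Nr2 -> Prop)
    (l0 : linking Nl1 Nl2) (r0 : linking Nr1 Nr2)
    (L : linking (choice Nl1 Nr1) (choice Nl2 Nr2)) : Prop :=
  exists l r k k', L = join (join l r) (tensor k k') /\
    mle k l0 /\ mle k' r0 /\ Bl (madd l k) /\ Br (madd r k').

Lemma proj1_choice (Nl1 Nl2 Nr1 Nr2 : PetriNet Act)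
    (l : linking Nl1 Nl2) (r : linking Nr1 Nr2)
    (s : mset (start_place Nl1 Nr1 * start_place Nl2 Nr2)) m n o :
  proj1_is (join (join l r) s) (choice_mark m n o) <->
  proj1_is l m /\ proj1_is r n /\ proj1_is s (on_start o).
Proof. unfold choice_mark; rewrite !proj1_join; tauto. Qed.

Lemma proj2_choice (Nl1 Nl2 Nr1 Nr2 : PetriNet Act)
    (l : linking Nl1 Nl2) (r : linking Nr1 Nr2)
    (s : mset (start_place Nl1 Nr1 * start_place Nl2 Nr2)) m n o :
  proj2_is (join (join l r) s) (choice_mark m n o) <->
  proj2_is l m /\ proj2_is r n /\ proj2_is s (on_start o).
Proof. unfold choice_mark; rewrite !proj2_join; tauto. Qed.

(** Postsets in a choice contain no start places, so the start part only loses links. *)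
Lemma choice_madd_msub (Nl1 Nl2 Nr1 Nr2 : PetriNet Act)
    (l c c' : linking Nl1 Nl2) (r d d' : linking Nr1 Nr2)
    (s e : mset (start_place Nl1 Nr1 * start_place Nl2 Nr2)) :
  madd (msub (join (join l r) s) (join (join c d) e)) (join (join c' d') mempty) =
  join (join (madd (msub l c) c') (madd (msub r d) d')) (msub s e).
Proof.
rewrite !join_madd_msub; f_equal.
extensionality p; unfold madd, mempty; lia.
Qed.

Lemma msub_mempty X (m : mset X) : msub m mempty = m.
Proof. extensionality p; unfold msub, mempty; lia. Qed.

Lemma choice_linkings_simulation (Nl1 Nl2 Nr1 Nr2 : PetriNet Act)
    (Bl : linking Nl1 Nl2 -> Prop) (Br : linking Nr1 Nr2 -> Prop)
    (l0 : linking Nl1 Nl2) (r0 : linking Nr1 Nr2) :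
  sp_simulation Bl -> sp_simulation Br ->
  proj1_is l0 (init Nl1) -> proj2_is l0 (init Nl2) ->
  proj1_is r0 (init Nr1) -> proj2_is r0 (init Nr2) ->
  plain (init Nl1) -> plain (init Nr1) ->
  nonempty (init Nl1) -> nonempty (init Nr1) ->
  sp_simulation (choice_linkings Bl Br l0 r0).
Proof.
intros HBl HBr P1 P2 Q1 Q2 HMl HMr Nl Nr c L t Hc
  [l [r [k [k' [-> [Hk [Hk' [Hl Hr]]]]]]]] Hp.
destruct (join_mle_inv Hc) as [c12 [c3 [-> [Hc12 Hc3]]]].
destruct (join_mle_inv Hc12) as [c1 [c2 [-> [Hc1 Hc2]]]].
assert (Z1 := fun X Y => @proj1_mempty X Y); assert (Z2 := fun X Y => @proj2_mempty X Y).
destruct t as [t1 | t1 | t1 K1 HK | t1 K1 HK]; apply proj1_choice in Hp;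
  destruct Hp as [Hp1 [Hp2 Hp3]].
- apply proj1_mempty_inv in Hp2; apply (@proj1_mempty_inv _ _ c3) in Hp3; subst c2 c3.
  destruct (sp_simulation_frame HBl Hl Hc1 Hp1) as [t2 [c' [H1 [H2 [H3 [H4 H5]]]]]].
  exists (choice_old1 _ t2), (join (join c' mempty) mempty); split; [exact H1|].
  split; [apply proj2_choice; repeat split; auto; apply Z2|].
  split; [apply proj1_choice; repeat split; auto; apply Z1|].
  split; [apply proj2_choice; repeat split; auto; apply Z2|].
  exists (madd (msub l c1) c'), r, k, k'; split; [|now repeat split].
  rewrite <- (madd_msub_mempty r) at 2; rewrite <- (msub_mempty (tensor k k')) at 2.
  apply choice_madd_msub.
- apply proj1_mempty_inv in Hp1; apply (@proj1_mempty_inv _ _ c3) in Hp3; subst c1 c3.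
  destruct (sp_simulation_frame HBr Hr Hc2 Hp2) as [t2 [c' [H1 [H2 [H3 [H4 H5]]]]]].
  exists (choice_old2 _ t2), (join (join mempty c') mempty); split; [exact H1|].
  split; [apply proj2_choice; repeat split; auto; apply Z2|].
  split; [apply proj1_choice; repeat split; auto; apply Z1|].
  split; [apply proj2_choice; repeat split; auto; apply Z2|].
  exists l, (madd (msub r c2) c'), k, k'; split; [|now repeat split].
  rewrite <- (madd_msub_mempty l) at 2; rewrite <- (msub_mempty (tensor k k')) at 2.
  apply choice_madd_msub.
- apply proj1_mempty_inv in Hp2; subst c2.
  assert (HKi : mle K1 (init Nl1)).
  { intro x; eapply Nat.le_trans; [apply (proj2 HK) | apply Nat.le_min_r]. }
  (* The preset projects to [K1] times the initial marking of [Nr1]; hence no right initial tokens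
     have been used and the fragment is [tensor d r0]. *)
  destruct (tensor_mle_inv_l P1 P2 Q1 Q2 HMl HMr Nr Hk Hk' Hc3 (proj1 HK) HKi Hp3)
    as [-> [d [Hd [Hpd ->]]]].
  destruct (sp_simulation_initial_part HBl P2 Hk Hl Hc1 Hd HK Hp1 Hpd)
    as [t2 [K2 [c' [HK2 [H1 [H2 [H3 [H4 [H5 H6]]]]]]]]].
  exists (choice_new1 _ HK2), (join (join c' mempty) mempty); split; [exact H1|].
  split; [apply proj2_choice; repeat split; auto|].
  { apply proj2_tensor; auto; intros x y; [|apply proj1_ge; exact Q1].
    eapply Nat.le_trans; [apply Hd|]; eapply Nat.le_trans; [apply Hk|].
    now apply proj1_ge. }
  split; [apply proj1_choice; repeat split; auto; apply Z1|].
  split; [apply proj2_choice; repeat split; auto; apply Z2|].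
  (* Removing [tensor d r0] takes [d] from the left initial links and keeps [r0] whole, so the right
     component stays as it was. *)
  exists (madd (msub l c1) c'), r, (msub k d), r0; split.
  { rewrite <- (madd_msub_mempty r) at 2; rewrite <- tensor_msub_l.
    apply choice_madd_msub. }
  repeat split; auto; intro p.
  eapply Nat.le_trans; [|apply Hk]; unfold msub; lia.
- apply proj1_mempty_inv in Hp1; subst c1.
  assert (HKi : mle K1 (init Nr1)).
  { intro x; eapply Nat.le_trans; [apply (proj2 HK) | apply Nat.le_min_r]. }
  destruct (tensor_mle_inv_r P1 P2 Q1 Q2 HMl HMr Nl Hk Hk' Hc3 (proj1 HK) HKi Hp3)
    as [-> [d [Hd [Hpd ->]]]].
  destruct (sp_simulation_initial_part HBr Q2 Hk' Hr Hc2 Hd HK Hp2 Hpd)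
    as [t2 [K2 [c' [HK2 [H1 [H2 [H3 [H4 [H5 H6]]]]]]]]].
  exists (choice_new2 _ HK2), (join (join mempty c') mempty); split; [exact H1|].
  split; [apply proj2_choice; repeat split; auto|].
  { apply proj2_tensor; auto; intros x y; [apply proj1_ge; exact P1|].
    eapply Nat.le_trans; [apply Hd|]; eapply Nat.le_trans; [apply Hk'|].
    now apply proj1_ge. }
  split; [apply proj1_choice; repeat split; auto; apply Z1|].
  split; [apply proj2_choice; repeat split; auto; apply Z2|].
  exists l, (madd (msub r c2) c'), l0, (msub k' d); split.
  { rewrite <- (madd_msub_mempty l) at 2; rewrite <- tensor_msub_r.
    apply choice_madd_msub. }
  repeat split; auto; intro p.
  eapply Nat.le_trans; [|apply Hk']; unfold msub; lia.
Qed.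

Lemma choice_linkings_converse (Nl1 Nl2 Nr1 Nr2 : PetriNet Act)
    (Bl : linking Nl1 Nl2 -> Prop) (Br : linking Nr1 Nr2 -> Prop)
    (l0 : linking Nl1 Nl2) (r0 : linking Nr1 Nr2) L :
  choice_linkings (converse Bl) (converse Br) (flip l0) (flip r0) L <->
  converse (choice_linkings Bl Br l0 r0) L.
Proof.
split; intros [l [r [k [k' [E [Hk [Hk' [Hl Hr]]]]]]]].
- exists (flip l), (flip r), (flip k), (flip k'); subst L; split.
  { unfold choice; simpl; etransitivity; [apply flip_join|].
    now rewrite flip_join, <- flip_tensor. }
  split; [intros [x y]; apply (Hk (y, x))|].
  split; [intros [x y]; apply (Hk' (y, x))|].
  now split.
- apply flip_eq_join in E; rewrite flip_join, flip_tensor in E; subst L.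
  exists (flip l), (flip r), (flip k), (flip k'); split; [reflexivity|].
  split; [intro; apply Hk|]; split; [intro; apply Hk'|].
  split; unfold converse;
    [replace (flip _) with (madd l k) | replace (flip _) with (madd r k')];
    solve [assumption | now mext].
Qed.

Lemma sp_bisimilar_choice (Nl1 Nl2 Nr1 Nr2 : PetriNet Act) :
  plain (init Nl1) -> plain (init Nr1) -> plain (init Nl2) -> plain (init Nr2) ->
  nonempty (init Nl1) -> nonempty (init Nr1) ->
  nonempty (init Nl2) -> nonempty (init Nr2) ->
  sp_bisimilar Nl1 Nl2 -> sp_bisimilar Nr1 Nr2 ->
  sp_bisimilar (choice Nl1 Nr1) (choice Nl2 Nr2).
Proof.
intros ? ? ? ? ? ? ? ?
  [HAl [Bl [HBl [l0 [Hl0 [P1 P2]]]]]] [HAr [Br [HBr [r0 [Hr0 [Q1 Q2]]]]]].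
split; [intro b; simpl; unfold union_type; now rewrite HAl, HAr|].
apply sp_bisimulation_iff in HBl, HBr; destruct HBl, HBr.
exists (choice_linkings Bl Br l0 r0); split.
- apply sp_bisimulation_iff; split; [now apply choice_linkings_simulation|].
  apply (sp_simulation_iff (choice_linkings_converse Bl Br l0 r0)).
  now apply choice_linkings_simulation.
(* Initially the ordinary places are unlinked and all initial links are still available, so [k] and
   [k'] are [l0] and [r0]. *)
- exists (join (join mempty mempty) (tensor l0 r0)); split; [|split].
  + exists mempty, mempty, l0, r0; repeat split; auto; intro; lia.
  + apply proj1_choice; split; [apply proj1_mempty|]; split; [apply proj1_mempty|].
    apply proj1_tensor; auto; intros x y; [apply (sums_to_ge x (P2 y)) | apply (sums_to_ge x (Q2 y))].
  + apply proj2_choice; split; [apply proj2_mempty|]; split; [apply proj2_mempty|].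
    apply proj2_tensor; auto; intros x y; now apply proj1_ge.
Qed.
End Choice.

Theorem theorem2 (Act : Type) (Act_infinite : ~ Finite Act)
    (N1 N2 Nl1 Nl2 Nr1 Nr2 : Net Act) (a : Act) (R : Act -> Act -> Prop) :
  (sp_bisimilar N1 N2 ->
     sp_bisimilar (prefix a N1) (prefix a N2) /\
     sp_bisimilar (relabel R N1) (relabel R N2))
  /\
  (sp_bisimilar Nl1 Nl2 -> sp_bisimilar Nr1 Nr2 ->
     sp_bisimilar (par Nl1 Nr1) (par Nl2 Nr2) /\
     (nonempty (init Nl1) /\ plain (init Nl1) ->
      nonempty (init Nr1) /\ plain (init Nr1) ->
      nonempty (init Nl2) /\ plain (init Nl2) ->
      nonempty (init Nr2) /\ plain (init Nr2) ->
      sp_bisimilar (choice Nl1 Nr1) (choice Nl2 Nr2))).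
Proof.
split.
- intro H; split; [now apply sp_bisimilar_prefix | now apply sp_bisimilar_relabel].
- intros Hl Hr; split; [now apply sp_bisimilar_par|].
  intros [? ?] [? ?] [? ?] [? ?]; now apply sp_bisimilar_choice.
Qed.
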